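(* Let $(T,m,u)$ be a monad on the left skew-closed category $(\mathcal{C},\mathbf{1},i,j,\Gamma,[-,-])$. Then $\mathcal{C}^T$ is left skew-closed in such a way that the forgetful functor $\mathcal{C}^T\to\mathcal{C}$ is strictly closed if and only if: (1) there is a morphism $\mu_{\mathbf{1}}\colon T\mathbf{1}\to\mathbf{1}$ such that $(\mathbf{1},\mu_{\mathbf{1}})\in\mathcal{C}^T$; (2) $T$ lifts $[-,-]$ via a natural transformation $s_{X,Y}\colon T[TX,Y]\to[X,TY]$, that is, $s$ satisfies for all $X,Y\in\mathcal{C}$ $$s_{X,Y}\circ u_{[TX,Y]}=[u_X,u_Y],$$ $$s_{X,Y}\circ m_{[TX,Y]}=[X,m_Y]\circ s_{X,TY}\circ Ts_{TX,Y}\circ T^2[m_X,Y];$$ and they satisfy $$Ti_X=i_{TX}\circ s_{\mathbf{1},X}\circ T[\mu_{\mathbf{1}},X]\qquad\text{for all }X\in\mathcal{C},$$ $$j_M\circ\mu_{\mathbf{1}}=[M,\mu_M\circ m_M]\circ s_{M,TM}\circ Tj_{TM}\qquad\text{for all }(M,\mu_M)\in\mathcal{C}^T,$$ and, for all $X,Y\in\mathcal{C}$ and $(P,\mu_P)\in\mathcal{C}^T$, $$\Gamma^P_{X,TY}\circ s_{X,Y}=[[\mu_P,X],s_{P,Y}]\circ s_{[TP,X],[TP,Y]}\circ T[s_{P,X},[\mu_P,Y]]\circ T\Gamma^P_{TX,Y}.$$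
   Context: $\mathcal{C}^T$ is the Eilenberg–Moore category of $T$-algebras $(M,\mu_M\colon TM\to M)$; $m\colon T^2\Rightarrow T$ and $u\colon\mathrm{id}\Rightarrow T$ are multiplication and unit. An object in a slot of a functor stands for its identity morphism. A (left) skew-closed category is a category $\mathcal{C}$ with an object $\mathbf{1}$, a functor $[-,-]\colon\mathcal{C}^{\mathrm{op}}\times\mathcal{C}\to\mathcal{C}$, a natural transformation $i_X\colon[\mathbf{1},X]\to X$, a dinatural transformation $j_X\colon\mathbf{1}\to[X,X]$, and morphisms $\Gamma^X_{Y,Z}\colon[Y,Z]\to[[X,Y],[X,Z]]$ natural in $Y,Z$ and dinatural in $X$, such that: $i_{\mathbf{1}}\circ j_{\mathbf{1}}=\mathrm{id}_{\mathbf 1}$; $i_{[X,Y]}\circ[j_X,[X,Y]]\circ\Gamma^X_{X,Y}=\mathrm{id}_{[X,Y]}$; $\Gamma^X_{Y,Y}\circ j_Y=j_{[X,Y]}$; $[[\mathbf{1},X],i_Y]\circ\Gamma^{\mathbf{1}}_{X,Y}=[i_X,Y]$; and $[\Gamma^U_{V,W},[[U,V],[U,X]]]\circ\Gamma^{[U,V]}_{[U,W],[U,X]}\circ\Gamma^U_{W,X}=[[V,W],\Gamma^U_{V,X}]\circ\Gamma^V_{W,X}$. A functor $F$ between skew-closed categories is strictly closed if $F\mathbf{1}=\mathbf{1}$, $F[X,Y]=[FX,FY]$ (naturally in $X,Y$), $F(i_X)=i_{FX}$, $F(j_X)=j_{FX}$ and $F(\Gamma^X_{Y,Z})=\Gamma^{FX}_{FY,FZ}$.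 Given $s$ as in (2), the induced lifting of $[-,-]$ to $\mathcal{C}^T$ equips $[M,N]$, for $(M,\mu_M),(N,\mu_N)\in\mathcal{C}^T$, with the $T$-action $[M,\mu_N]\circ s_{M,N}\circ T[\mu_M,N]$. *)

(* Defs.v *)
From Stdlib Require Import ProofIrrelevance.

Set Implicit Arguments.
Unset Strict Implicit.
Unset Printing Implicit Defensive.

Declare Scope cat_scope.
Delimit Scope cat_scope with cat.
Open Scope cat_scope.

Record Category : Type := {
  ob :> Type;
  hom : ob -> ob -> Type;
  idm : forall X, hom X X;
  comp : forall X Y Z, hom Y Z -> hom X Y -> hom X Z;
  comp_id_l : forall X Y (f : hom X Y), comp (idm Y) f = f;
  comp_id_r : forall X Y (f : hom X Y), comp f (idm X) = f;
  comp_assoc : forall W X Y Z (h : hom Y Z) (g : hom X Y) (f : hom W X),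
    comp h (comp g f) = comp (comp h g) f
}.

Arguments hom {c} X Y.
Arguments idm {c} X.
Arguments comp {c X Y Z} g f.
Notation "g ∘ f" := (comp g f) (at level 40, left associativity) : cat_scope.

Record Functor (C D : Category) : Type := {
  fobj :> C -> D;
  fmap : forall X Y : C, hom X Y -> hom (fobj X) (fobj Y);
  fmap_id : forall X : C, fmap (idm X) = idm (fobj X);
  fmap_comp : forall (X Y Z : C) (g : hom Y Z) (f : hom X Y),
    fmap (g ∘ f) = fmap g ∘ fmap f
}.

Arguments fmap {C D} F {X Y} f : rename.

Definition op (C : Category) : Category.
Proof.
refine {| ob := C;
          hom := fun X Y => @hom C Y X;
          idm := fun X => @idm C X;
          comp := fun X Y Z g f => @comp C Z Y X f g |}.
- intros; apply comp_id_r.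
- intros; apply comp_id_l.
- intros; symmetry; apply comp_assoc.
Defined.

Definition prod_cat (C D : Category) : Category.
Proof.
refine {| ob := (C * D)%type;
          hom := fun X Y => (@hom C (fst X) (fst Y) * @hom D (snd X) (snd Y))%type;
          idm := fun X => (idm (fst X), idm (snd X));
          comp := fun X Y Z g f => (fst g ∘ fst f, snd g ∘ snd f) |}.
- intros X Y [f g]; simpl; now rewrite !comp_id_l.
- intros X Y [f g]; simpl; now rewrite !comp_id_r.
- intros; simpl; now rewrite !comp_assoc.
Defined.

Definition bobj (C : Category) (H : Functor (prod_cat (op C) C) C) (X Y : C) : C :=
  H (X, Y).

Definition bmap (C : Category) (H : Functor (prod_cat (op C) C) C)
    (X X' Y Y' : C) (f : hom X' X) (g : hom Y Y') :
    hom (bobj H X Y) (bobj H X' Y') :=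
  @fmap _ _ H (X, Y) (X', Y') (f, g).

Section SkewClosedAxioms.

Variables (C : Category) (one : C) (H : Functor (prod_cat (op C) C) C).
Local Notation "⟦ X , Y ⟧" := (bobj H X Y).
Local Notation "⟪ f , g ⟫" := (bmap H f g).
Variables (i : forall X : C, hom ⟦one, X⟧ X)
  (j : forall X : C, hom one ⟦X, X⟧)
  (Γ : forall X Y Z : C, hom ⟦Y, Z⟧ ⟦⟦X, Y⟧, ⟦X, Z⟧⟧).

Record skew_closed_axioms : Prop := {
  i_natural : forall (X Y : C) (f : hom X Y),
    f ∘ i X = i Y ∘ ⟪idm one, f⟫;
  j_dinatural : forall (X Y : C) (f : hom X Y),
    ⟪idm X, f⟫ ∘ j X = ⟪f, idm Y⟫ ∘ j Y;
  Γ_natural : forall (X Y Y' Z Z' : C) (f : hom Y' Y) (g : hom Z Z'),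
    ⟪⟪idm X, f⟫, ⟪idm X, g⟫⟫ ∘ Γ X Y Z = Γ X Y' Z' ∘ ⟪f, g⟫;
  Γ_dinatural : forall (X X' Y Z : C) (f : hom X X'),
    ⟪⟪f, idm Y⟫, idm ⟦X, Z⟧⟫ ∘ Γ X Y Z
    = ⟪idm ⟦X', Y⟧, ⟪f, idm Z⟫⟫ ∘ Γ X' Y Z;
  skew_ij : i one ∘ j one = idm one;
  skew_ijΓ : forall X Y : C,
    i ⟦X, Y⟧ ∘ ⟪j X, idm ⟦X, Y⟧⟫ ∘ Γ X X Y = idm ⟦X, Y⟧;
  skew_Γj : forall X Y : C, Γ X Y Y ∘ j Y = j ⟦X, Y⟧;
  skew_iΓ : forall X Y : C,
    ⟪idm ⟦one, X⟧, i Y⟫ ∘ Γ one X Y = ⟪i X, idm Y⟫;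
  skew_ΓΓ : forall U V W X : C,
    ⟪Γ U V W, idm ⟦⟦U, V⟧, ⟦U, X⟧⟧⟫ ∘ Γ ⟦U, V⟧ ⟦U, W⟧ ⟦U, X⟧ ∘ Γ U W X
    = ⟪idm ⟦V, W⟧, Γ U V X⟫ ∘ Γ V W X
}.

End SkewClosedAxioms.

Class SkewClosed (C : Category) : Type := {
  one : C;
  ihom : Functor (prod_cat (op C) C) C;
  i : forall X : C, hom (bobj ihom one X) X;
  j : forall X : C, hom one (bobj ihom X X);
  Γ : forall X Y Z : C,
    hom (bobj ihom Y Z) (bobj ihom (bobj ihom X Y) (bobj ihom X Z));
  skew_closed_ax : skew_closed_axioms i j Γ
}.

Arguments one {C SkewClosed}.
Arguments ihom {C SkewClosed}.
Arguments i {C SkewClosed} X.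
Arguments j {C SkewClosed} X.
Arguments Γ {C SkewClosed} X Y Z.
Notation "⟦ X , Y ⟧" := (bobj ihom X Y) : cat_scope.
Notation "⟪ f , g ⟫" := (bmap ihom f g) : cat_scope.

(* Equality in the class of all morphisms of a category: f and g are equal
   together with their domains and codomains.  JMeq on hom-types
   would be weaker: it does not force the objects to agree. *)
Record Arrow (C : Category) : Type := mkArrow {
  dom : C;
  cod : C;
  arr : hom dom cod
}.

Notation "f ≡ g" := (mkArrow f = mkArrow g) (at level 70) : cat_scope.

Record StrictlyClosed (C D : Category) {SC : SkewClosed C} {SD : SkewClosed D}
    (F : Functor C D) : Prop := {
  strict_one : F one = one;
  strict_hom : forall X Y : C, F ⟦X, Y⟧ = ⟦F X, F Y⟧;
  strict_hom_natural : forall (X X' Y Y' : C) (f : hom X' X) (g : hom Y Y'),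
    fmap F ⟪f, g⟫ ≡ ⟪fmap F f, fmap F g⟫;
  strict_i : forall X : C, fmap F (i X) ≡ i (F X);
  strict_j : forall X : C, fmap F (j X) ≡ j (F X);
  strict_Γ : forall X Y Z : C, fmap F (Γ X Y Z) ≡ Γ (F X) (F Y) (F Z)
}.

Arguments StrictlyClosed {C D} SC SD F.

Record Monad (C : Category) : Type := {
  endo :> Functor C C;
  m : forall X : C, hom (endo (endo X)) (endo X);
  u : forall X : C, hom X (endo X);
  m_natural : forall (X Y : C) (f : hom X Y),
    m Y ∘ fmap endo (fmap endo f) = fmap endo f ∘ m X;
  u_natural : forall (X Y : C) (f : hom X Y),
    u Y ∘ f = fmap endo f ∘ u X;
  m_unit_l : forall X : C, m X ∘ u (endo X) = idm (endo X);
  m_unit_r : forall X : C, m X ∘ fmap endo (u X) = idm (endo X);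
  m_assoc : forall X : C, m X ∘ m (endo X) = m X ∘ fmap endo (m X)
}.

Arguments m {C} T X : rename.
Arguments u {C} T X : rename.

Section EilenbergMoore.

Variables (C : Category) (T : Monad C).

Record is_algebra (M : C) (μ : hom (T M) M) : Prop := {
  alg_unit : μ ∘ u T M = idm M;
  alg_mult : μ ∘ m T M = μ ∘ fmap T μ
}.

Record Algebra : Type := {
  carrier :> C;
  act : hom (T carrier) carrier;
  act_is_algebra : is_algebra act
}.

Record AlgHom (M N : Algebra) : Type := {
  alg_fun :> hom (carrier M) (carrier N);
  alg_fun_comm : alg_fun ∘ act M = act N ∘ fmap T alg_fun
}.

Lemma AlgHom_eq (M N : Algebra) (f g : AlgHom M N) :
  alg_fun f = alg_fun g -> f = g.
Proof.
destruct f as [f pf], g as [g pg]; simpl; intros e; subst g.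
now rewrite (proof_irrelevance _ pf pg).
Qed.

Definition AlgHom_id (M : Algebra) : AlgHom M M.
Proof.
exists (idm (carrier M)).
now rewrite fmap_id, comp_id_l, comp_id_r.
Defined.

Definition AlgHom_comp (M N P : Algebra) (g : AlgHom N P) (f : AlgHom M N) :
  AlgHom M P.
Proof.
exists (alg_fun g ∘ alg_fun f).
now rewrite fmap_comp, <- comp_assoc, alg_fun_comm, !comp_assoc, alg_fun_comm.
Defined.

Definition EM : Category.
Proof.
refine {| ob := Algebra; hom := AlgHom; idm := AlgHom_id; comp := AlgHom_comp |}.
- intros; apply AlgHom_eq, comp_id_l.
- intros; apply AlgHom_eq, comp_id_r.
- intros; apply AlgHom_eq, comp_assoc.
Defined.

Definition forget : Functor EM C.
Proof.
refine {| fobj := carrier : EM -> C;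
          fmap := fun (M N : EM) (f : hom M N) => alg_fun f |}.
- reflexivity.
- reflexivity.
Defined.

End EilenbergMoore.

Arguments act {C T} M : rename.

Section Lifting.

Variables (C : Category) (SC : SkewClosed C) (T : Monad C).

Record lifts_hom (s : forall X Y : C, hom (T ⟦T X, Y⟧) ⟦X, T Y⟧) : Prop := {
  s_natural : forall (X X' Y Y' : C) (f : hom X' X) (g : hom Y Y'),
    s X' Y' ∘ fmap T ⟪fmap T f, g⟫ = ⟪f, fmap T g⟫ ∘ s X Y;
  s_u : forall X Y : C, s X Y ∘ u T ⟦T X, Y⟧ = ⟪u T X, u T Y⟫;
  s_m : forall X Y : C,
    s X Y ∘ m T ⟦T X, Y⟧
    = ⟪idm X, m T Y⟫ ∘ s X (T Y) ∘ fmap T (s (T X) Y)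
        ∘ fmap T (fmap T ⟪m T X, idm Y⟫)
}.

End Lifting.

Arguments lifts_hom {C SC} T s.

(* Main.v *)
Require Import Defs.
From Stdlib Require Import ProofIrrelevance.

(** The forgetful functor is faithful, and it determines the structure that
    [EM T] must carry: a skew-closed structure on algebras lying strictly over
    the one of [C] is the same thing as an action [μ1] on the unit object and an
    action [a M N] on every internal hom of carriers, natural in algebra
    homomorphisms, for which the components of [i], [j] and [Γ] are themselves
    algebra homomorphisms ([has_lifted_structure]).  The five axioms then hold
    for free because they hold in [C] ([EM_skew_closed]).  In the other direction
    strictness only gives equalities between carriers, so the actions
    are transported along them; proof irrelevance makes the transported data
    independent of the chosen equality ([cast_act_equivariant],
    [strict_act_cast]).

    It remains to trade the actions [a] for the transformation [s].  A natural
    family of actions is determined by its values on free algebras: every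
    algebra is a retract, in [C], of the free algebra on its carrier, with
    retraction the homomorphism [act M] and section [u].  Restricting [a] to free
    algebras along the unit gives [s] ([lift_of]); the induced lifting
    [⟪M, act N⟫ ∘ s ∘ T⟪act M, N⟫] gives [a] back ([action_of]).  These
    constructions are mutually inverse ([action_of_lift_of],
    [lift_of_action_of]), the algebra laws for [a] match the two laws for [s]
    ([action_of_lifted], [lift_of_lifts]), and, once [a] is written through [s],
    equivariance of [i], [j] and [Γ] becomes the three displayed equations
    ([i_coherence], [j_coherence], [Γ_coherence]). *)

Set Implicit Arguments.
Unset Strict Implicit.
Unset Printing Implicit Defensive.

(** * Calculus of the internal hom *)

Section Calculus.

Context {C : Category} {SC : SkewClosed C}.

(** Lets an equation between composites be used at the end of a longer
    left-associated chain. *)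
Lemma comp_tail (W X Y : C) (g : hom X Y) (f : hom W X) (h : hom W Y) :
  g ∘ f = h -> forall (Z : C) (k : hom Y Z), k ∘ g ∘ f = k ∘ h.
Proof. intros e Z k; now rewrite <- comp_assoc, e. Qed.

Lemma bmap_id (X Y : C) : ⟪idm X, idm Y⟫ = idm ⟦X, Y⟧.
Proof. exact (fmap_id ihom (X, Y)). Qed.

Lemma bmap_comp (X X' X'' Y Y' Y'' : C) (f' : hom X'' X') (g' : hom Y' Y'')
    (f : hom X' X) (g : hom Y Y') :
  ⟪f', g'⟫ ∘ ⟪f, g⟫ = ⟪f ∘ f', g' ∘ g⟫.
Proof.
symmetry.
exact (@fmap_comp _ _ ihom (X, Y) (X', Y') (X'', Y'') (f', g') (f, g)).
Qed.

End Calculus.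

(** Normalises to a left-associated chain in which adjacent internal homs are
    fused into one and adjacent functor images are gathered under a single
    [fmap].  Functoriality then needs no separate steps: only naturality and
    the axioms of the data remain visible in the proofs. *)
Ltac merge :=
  repeat first
    [ rewrite comp_assoc | rewrite comp_id_l | rewrite comp_id_r
    | rewrite fmap_id | rewrite bmap_id
    | rewrite bmap_comp | rewrite (comp_tail (bmap_comp _ _ _ _))
    | rewrite <- fmap_comp
    | rewrite (comp_tail (eq_sym (fmap_comp _ _ _))) ].

(** Rewriting where carriers of free algebras and of hom algebras must be
    computed on both sides before terms match syntactically. *)
Tactic Notation "rw" uconstr(c) :=
  let H := fresh in pose proof c as H; cbn in H |- *; rewrite H; clear H.
Tactic Notation "rw" "<-" uconstr(c) :=
  let H := fresh in pose proof c as H; cbn in H |- *; rewrite <- H; clear H.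

(** * Actions on internal homs and the transformation [s] *)

Section Lifts.

Context {C : Category} {SC : SkewClosed C} {T : Monad C}.

Local Notation lift_family :=
  (forall X Y : C, hom (T ⟦T X, Y⟧) ⟦X, T Y⟧).
Local Notation action_family :=
  (forall M N : EM T,
     hom (T ⟦carrier M, carrier N⟧) ⟦carrier M, carrier N⟧).

Definition free (X : C) : EM T :=
  @Build_Algebra C T (T X) (m T X)
    (@Build_is_algebra C T (T X) (m T X) (m_unit_l T X) (m_assoc T X)).

Definition free_map (X Y : C) (f : hom X Y) : @hom (EM T) (free X) (free Y) :=
  @Build_AlgHom C T (free X) (free Y) (fmap T f) (eq_sym (m_natural T f)).

Definition act_hom (M : EM T) : @hom (EM T) (free (carrier M)) M :=
  @Build_AlgHom C T (free (carrier M)) M (act M)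
    (alg_mult (act_is_algebra M)).

Definition action_of (s : lift_family) (M N : EM T) :
    hom (T ⟦carrier M, carrier N⟧) ⟦carrier M, carrier N⟧ :=
  ⟪idm (carrier M), act N⟫ ∘ s (carrier M) (carrier N)
    ∘ fmap T ⟪act M, idm (carrier N)⟫.

Definition lift_of (a : action_family) (X Y : C) : hom (T ⟦T X, Y⟧) ⟦X, T Y⟧ :=
  ⟪u T X, idm (T Y)⟫ ∘ a (free X) (free Y) ∘ fmap T ⟪idm (T X), u T Y⟫.

Record lifted_action (a : action_family) : Prop := {
  action_algebra : forall M N : EM T, is_algebra (a M N);
  action_natural : forall (M M' N N' : EM T)
      (f : @hom (EM T) M' M) (g : @hom (EM T) N N'),
    ⟪alg_fun f, alg_fun g⟫ ∘ a M N = a M' N' ∘ fmap T ⟪alg_fun f, alg_fun g⟫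
}.

Section FromLift.

Variable s : lift_family.
Hypothesis Hs : lifts_hom T s.

Lemma lift_natural_l (X X' Y : C) (f : hom X' X) :
  s X' Y ∘ fmap T ⟪fmap T f, idm Y⟫ = ⟪f, idm (T Y)⟫ ∘ s X Y.
Proof. now rewrite (s_natural Hs), fmap_id. Qed.

Lemma lift_natural_r (X Y Y' : C) (g : hom Y Y') :
  s X Y' ∘ fmap T ⟪idm (T X), g⟫ = ⟪idm X, fmap T g⟫ ∘ s X Y.
Proof. now rewrite <- (s_natural Hs), fmap_id. Qed.

(** Naturality of [s], used to move everything covariant out through the second
    slot and everything contravariant in through the first.  Both sides of the
    condition on [Γ] are compared after being brought to this form. *)
Lemma lift_slide (A B V X X' Y Y' : C) (f : hom X' X) (g : hom Y Y')
    (α : hom (T X) A) (β : hom (T Y') B) (k : hom V ⟦A, Y⟧) :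
  ⟪f, β⟫ ∘ s X Y' ∘ fmap T (⟪α, g⟫ ∘ k)
  = ⟪idm X', β ∘ fmap T g⟫ ∘ s X' Y ∘ fmap T (⟪α ∘ fmap T f, idm Y⟫ ∘ k).
Proof.
transitivity (⟪idm X', β⟫ ∘ (⟪f, fmap T g⟫ ∘ s X Y) ∘ fmap T (⟪α, idm Y⟫ ∘ k)).
- transitivity (⟪f, β⟫ ∘ (s X Y' ∘ fmap T ⟪idm (T X), g⟫)
    ∘ fmap T (⟪α, idm Y⟫ ∘ k)).
  { now merge. }
  rewrite lift_natural_r; now merge.
- transitivity (⟪idm X', β ∘ fmap T g⟫ ∘ (⟪f, idm (T Y)⟫ ∘ s X Y)
    ∘ fmap T (⟪α, idm Y⟫ ∘ k)).
  { now merge. }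
  rewrite <- lift_natural_l; now merge.
Qed.

(** The unit law of [s] gives the unit law of the action.  For the
    multiplication law, the maps [m] that [s_m] produces on either side are
    absorbed by the algebra laws of [M] and [N], turning them into [T (act _)],
    which naturality of [s] then moves into place. *)
Lemma action_of_lifted : lifted_action (action_of s).
Proof.
split.
- intros M N; unfold action_of; split.
  + rewrite <- comp_assoc, <- u_natural, comp_assoc.
    rewrite (comp_tail (s_u Hs _ _)); merge.
    now rewrite !(alg_unit (act_is_algebra _)), bmap_id.
  + rewrite <- comp_assoc, <- m_natural, comp_assoc.
    rewrite (comp_tail (s_m Hs _ _)); merge.
    (* Both actions now meet [T] of an action instead of [m]; [s] slides past
       these. *)
    rewrite !(alg_mult (act_is_algebra _)).
    transitivity (⟪idm (carrier M), act N⟫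
      ∘ (⟪idm (carrier M), fmap T (act N)⟫ ∘ s (carrier M) (T (carrier N)))
      ∘ fmap T ((s (T (carrier M)) (carrier N)
                  ∘ fmap T ⟪fmap T (act M), idm (carrier N)⟫)
               ∘ fmap T ⟪act M, idm (carrier N)⟫)).
    { now merge. }
    rewrite lift_natural_l, <- lift_natural_r; now merge.
- intros M M' N N' f g; unfold action_of; merge.
  rewrite !alg_fun_comm.
  transitivity (⟪idm (carrier M'), act N'⟫
    ∘ (⟪alg_fun f, fmap T (alg_fun g)⟫ ∘ s (carrier M) (carrier N))
    ∘ fmap T ⟪act M, idm (carrier N)⟫).
  { now merge. }
  rewrite <- (s_natural Hs); now merge.
Qed.

(** On a free codomain the action restricts along the unit to [s] itself, up to
    the contravariant action: [m] cancels against [T u].  This is how the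
    equations on [s] are read off from those on actions. *)
Lemma action_of_free_r (M : EM T) (Y : C) :
  action_of s M (free Y) ∘ fmap T ⟪idm (carrier M), u T Y⟫
  = s (carrier M) Y ∘ fmap T ⟪act M, idm Y⟫.
Proof.
unfold action_of; cbn [free carrier act]; merge.
transitivity (⟪idm (carrier M), m T Y⟫
  ∘ (s (carrier M) (T Y) ∘ fmap T ⟪idm (T (carrier M)), u T Y⟫)
  ∘ fmap T ⟪act M, idm Y⟫).
{ now merge. }
rewrite lift_natural_r; merge.
rewrite m_unit_r, bmap_id; now merge.
Qed.

Lemma lift_of_action_of (X Y : C) : lift_of (action_of s) X Y = s X Y.
Proof.
unfold lift_of; rewrite <- comp_assoc.
rw (action_of_free_r (free X) Y); rewrite comp_assoc.
rewrite <- lift_natural_l; merge.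
rewrite m_unit_r, bmap_id; now merge.
Qed.

End FromLift.

Section FromAction.

Variable a : action_family.
Hypothesis Ha : lifted_action a.

(** The laws of an action at free algebras give those of [s].  In the [s_m] law,
    naturality of [a] is used along the homomorphisms [m : free (T X) -> free X]
    and [m : free (T Y) -> free Y]; the units inserted by [lift_of] cancel against
    these, leaving the action applied twice. *)
Lemma lift_of_lifts : lifts_hom T (lift_of a).
Proof.
split.
- intros X X' Y Y' f g; unfold lift_of; merge.
  transitivity (⟪u T X', idm (T Y')⟫
    ∘ (a (free X') (free Y') ∘ fmap T ⟪fmap T f, fmap T g⟫)
    ∘ fmap T ⟪idm (T X), u T Y⟫).
  { merge; now rewrite (u_natural T g). }
  rw <- (action_natural Ha (free_map f) (free_map g)); merge.
  now rewrite (u_natural T f).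
- intros X Y; unfold lift_of.
  rewrite <- comp_assoc, <- u_natural; merge.
  rw (comp_tail (alg_unit (action_algebra Ha (free X) (free Y)))).
  now merge.
- intros X Y; unfold lift_of.
  rewrite <- comp_assoc, <- m_natural, comp_assoc.
  rw (comp_tail (alg_mult (action_algebra Ha (free X) (free Y)))).
  symmetry.
  transitivity (⟪u T X, idm (T Y)⟫
    ∘ (⟪idm (T X), m T Y⟫ ∘ a (free X) (free (T Y)))
    ∘ fmap T (⟪u T (T X), u T (T Y)⟫
      ∘ (a (free (T X)) (free Y)
         ∘ fmap T ⟪m T X, idm (T Y)⟫) ∘ fmap T ⟪idm (T X), u T Y⟫)).
  { now merge. }
  rw (action_natural Ha (AlgHom_id (free X)) (act_hom (free Y))).
  rw <- (action_natural Ha (act_hom (free X)) (AlgHom_id (free Y))).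
  cbn; merge.
  rewrite !m_unit_l, bmap_id; now merge.
Qed.

(** Naturality along [act M] and [act N] carries the action from free algebras to
    [M] and [N], where the unit laws of the algebras remove the units of
    [lift_of]. *)
Lemma action_of_lift_of (M N : EM T) : action_of (lift_of a) M N = a M N.
Proof.
unfold action_of, lift_of; merge.
transitivity (⟪u T (carrier M), idm (carrier N)⟫
  ∘ (⟪idm (T (carrier M)), act N⟫ ∘ a (free (carrier M)) (free (carrier N)))
  ∘ fmap T ⟪act M, u T (carrier N)⟫).
{ now merge. }
rw (action_natural Ha (AlgHom_id (free (carrier M))) (act_hom N)).
cbn; merge.
rewrite (alg_unit (act_is_algebra N)).
rw (comp_tail (eq_sym (action_natural Ha (act_hom M) (AlgHom_id N)))).
cbn; merge.
rewrite (alg_unit (act_is_algebra M)); now merge.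
Qed.

End FromAction.

Definition hom_algebra
    (a : action_family)
    (L : lifted_action a) (M N : EM T) : EM T :=
  @Build_Algebra C T ⟦carrier M, carrier N⟧ (a M N) (action_algebra L M N).


Record coherent_action (μ1 : hom (T one) one) (H1 : is_algebra μ1)
    (a : action_family)
    (L : lifted_action a) : Prop := {
  i_equivariant : forall M : EM T,
    i (carrier M) ∘ a (Build_Algebra H1) M = act M ∘ fmap T (i (carrier M));
  j_equivariant : forall M : EM T,
    j (carrier M) ∘ μ1 = a M M ∘ fmap T (j (carrier M));
  Γ_equivariant : forall P M N : EM T,
    Γ (carrier P) (carrier M) (carrier N) ∘ a M N
    = a (hom_algebra L P M) (hom_algebra L P N)
        ∘ fmap T (Γ (carrier P) (carrier M) (carrier N))
}.

(** * Equivariance of the structure maps in terms of [s] *)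

Section Coherence.

Variable s : lift_family.
Hypothesis Hs : lifts_hom T s.
Variable a : action_family.
Hypothesis L : lifted_action a.
Hypothesis a_def : forall M N, a M N = action_of s M N.

(** From equivariance to the equation: instantiate at free algebras and
    precompose with [T] of the internal hom into [u].  Conversely, postcompose the equation with the action
    of [M] and use naturality of [i]. *)
Lemma i_coherence (μ1 : hom (T one) one) (H1 : is_algebra μ1) :
  (forall M : EM T,
    i (carrier M) ∘ a (Build_Algebra H1) M = act M ∘ fmap T (i (carrier M)))
  <->
  (forall X : C, fmap T (i X) = i (T X) ∘ s one X ∘ fmap T ⟪μ1, idm X⟫).
Proof.
pose proof (i_natural (skew_closed_ax (SkewClosed := SC))) as nat.
split.
- intros E X.
  rewrite <- comp_assoc.
  rw <- (action_of_free_r Hs (Build_Algebra H1) X).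
  rw <- (a_def (Build_Algebra H1) (free X)); rewrite comp_assoc.
  rw (E (free X)); merge.
  rewrite <- nat; merge. rewrite fmap_comp, comp_assoc.
  now rewrite m_unit_r, comp_id_l.
- intros E M; rewrite E, a_def; unfold action_of; merge.
  now rewrite nat.
Qed.

(** The right-hand sides agree for each [M]: by dinaturality of [j] along [act M],
    the contravariant [act M] of the lifted action becomes a covariant one, which
    passes through [s] and combines into [act M ∘ m]. *)
Lemma j_coherence (μ1 : hom (T one) one) :
  (forall M : EM T, j (carrier M) ∘ μ1 = a M M ∘ fmap T (j (carrier M)))
  <->
  (forall M : EM T,
     j (carrier M) ∘ μ1
     = ⟪idm (carrier M), act M ∘ m T (carrier M)⟫
         ∘ s (carrier M) (T (carrier M)) ∘ fmap T (j (T (carrier M)))).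
Proof.
pose proof (j_dinatural (skew_closed_ax (SkewClosed := SC))) as dinat.
assert (E : forall M : EM T,
  a M M ∘ fmap T (j (carrier M))
  = ⟪idm (carrier M), act M ∘ m T (carrier M)⟫
      ∘ s (carrier M) (T (carrier M)) ∘ fmap T (j (T (carrier M)))).
{ intros M; rewrite a_def; unfold action_of; merge.
  rewrite <- dinat, fmap_comp, comp_assoc.
  rewrite (comp_tail (lift_natural_r Hs _ _)); merge.
  now rewrite (alg_mult (act_is_algebra M)). }
split; intros F M; rewrite F; [|symmetry]; apply E.
Qed.

(** As for [i], the equation is equivariance at free algebras [free X], [free Y]
    composed with units on both sides; [P] stays an arbitrary algebra because
    [Γ] is only dinatural in it.  Naturality of [Γ] moves units and actions across, and
    sliding them through the outer [s] lets them meet the inner actions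
    [a P _], which they reduce to [s] (or, conversely, from which they are
    assembled). *)
Lemma Γ_coherence :
  (forall P M N : EM T,
    Γ (carrier P) (carrier M) (carrier N) ∘ a M N
    = a (hom_algebra L P M) (hom_algebra L P N)
        ∘ fmap T (Γ (carrier P) (carrier M) (carrier N)))
  <->
  (forall (X Y : C) (P : EM T),
     Γ (carrier P) X (T Y) ∘ s X Y
     = ⟪⟪act P, idm X⟫, s (carrier P) Y⟫
         ∘ s ⟦T (carrier P), X⟧ ⟦T (carrier P), Y⟧
         ∘ fmap T ⟪s (carrier P) X, ⟪act P, idm Y⟫⟫
         ∘ fmap T (Γ (carrier P) (T X) Y)).
Proof.
pose proof (Γ_natural (skew_closed_ax (SkewClosed := SC))) as nat.
(* The actions on the inner homs enter through both slots of the outer one. *)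
assert (aa : forall P M N : EM T,
  a (hom_algebra L P M) (hom_algebra L P N)
  = ⟪idm _, a P N⟫ ∘ s ⟦carrier P, carrier M⟧ ⟦carrier P, carrier N⟧
      ∘ fmap T ⟪a P M, idm _⟫).
{ intros P M N; now rewrite a_def. }
split.
- intros E X Y P.
  transitivity (⟪⟪idm _, u T X⟫, ⟪idm _, idm _⟫⟫
    ∘ (Γ (carrier P) (T X) (T Y) ∘ a (free X) (free Y))
    ∘ fmap T ⟪idm (T X), u T Y⟫).
  { rewrite <- (lift_of_action_of Hs X Y); unfold lift_of.
    rewrite <- a_def, !comp_assoc, nat; now merge. }
  rw (E P (free X) (free Y)).
  rw (aa P (free X) (free Y)).
  transitivity (⟪⟪idm _, u T X⟫, a P (free Y)⟫
    ∘ s ⟦carrier P, T X⟧ ⟦carrier P, T Y⟧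
    ∘ fmap T (⟪a P (free X), idm _⟫
      ∘ (Γ (carrier P) (T X) (T Y) ∘ ⟪idm (T X), u T Y⟫))).
  { now merge. }
  rewrite <- nat; merge.
  rewrite (lift_slide Hs).
  rw (a_def P (free X)). rw (a_def P (free Y)).
  rw (action_of_free_r Hs P X).
  rw (action_of_free_r Hs P Y).
  symmetry; apply (lift_slide Hs).
- intros E P M N.
  rewrite aa, !a_def; unfold action_of; merge.
  transitivity (⟪⟪idm _, idm _⟫, ⟪idm _, act N⟫⟫
    ∘ (Γ (carrier P) (carrier M) (T (carrier N)) ∘ s (carrier M) (carrier N))
    ∘ fmap T ⟪act M, idm _⟫).
  { rewrite !comp_assoc, nat; now merge. }
  rewrite E; merge.
  transitivity (⟪⟪act P, idm _⟫, ⟪idm _, act N⟫ ∘ s (carrier P) (carrier N)⟫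
    ∘ s ⟦T (carrier P), carrier M⟧ ⟦T (carrier P), carrier N⟧
    ∘ fmap T (⟪s (carrier P) (carrier M), ⟪act P, idm _⟫⟫
      ∘ (Γ (carrier P) (T (carrier M)) (carrier N) ∘ ⟪act M, idm _⟫))).
  { now merge. }
  rewrite <- nat; merge.
  rewrite (lift_slide Hs); now merge.
Qed.

End Coherence.

(** * Skew-closed structures strictly over the base *)

(** Skew-closed structure on algebras whose carriers are those of [C] on the
    nose rather than up to an equality of objects. *)
Definition has_lifted_structure : Prop :=
  exists (μ1 : hom (T one) one) (H1 : is_algebra μ1)
    (a : action_family) (L : lifted_action a), coherent_action H1 L.

Section Construction.

Variables (μ1 : hom (T one) one) (H1 : is_algebra μ1)
  (a : action_family) (L : lifted_action a) (K : coherent_action H1 L).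

Definition EM_ihom : Functor (prod_cat (op (EM T)) (EM T)) (EM T).
Proof.
refine (@Build_Functor (prod_cat (op (EM T)) (EM T)) (EM T)
  (fun P => hom_algebra L (fst P) (snd P))
  (fun P Q (h : @hom (prod_cat (op (EM T)) (EM T)) P Q) =>
     @Build_AlgHom C T (hom_algebra L (fst P) (snd P))
       (hom_algebra L (fst Q) (snd Q))
       ⟪alg_fun (fst h), alg_fun (snd h)⟫
       (action_natural L (fst h) (snd h)))
  _ _).
- intros P; apply AlgHom_eq; cbn; apply bmap_id.
- intros P Q R h k; apply AlgHom_eq; cbn; symmetry; apply bmap_comp.
Defined.

Definition EM_skew_closed : SkewClosed (EM T).
Proof.
unshelve refine (@Build_SkewClosed (EM T) (Build_Algebra H1) EM_ihom
  (fun M => @Build_AlgHom C T (hom_algebra L (Build_Algebra H1) M) M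
     (i (carrier M)) (i_equivariant K M))
  (fun M => @Build_AlgHom C T (Build_Algebra H1) (hom_algebra L M M)
     (j (carrier M)) (j_equivariant K M))
  (fun P M N => @Build_AlgHom C T (hom_algebra L M N)
     (hom_algebra L (hom_algebra L P M) (hom_algebra L P N))
     (Γ (carrier P) (carrier M) (carrier N)) (Γ_equivariant K P M N))
  _).
split; intros; apply AlgHom_eq; cbn.
- apply (i_natural skew_closed_ax).
- apply (j_dinatural skew_closed_ax).
- apply (Γ_natural skew_closed_ax).
- apply (Γ_dinatural skew_closed_ax).
- apply (skew_ij skew_closed_ax).
- apply (skew_ijΓ skew_closed_ax).
- apply (skew_Γj skew_closed_ax).
- apply (skew_iΓ skew_closed_ax).
- apply (skew_ΓΓ skew_closed_ax).
Defined.

Lemma EM_strictly_closed : StrictlyClosed EM_skew_closed SC (forget T).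
Proof. now split. Qed.

End Construction.

(** Equality of packaged arrows is only useful at fixed endpoints, where
    uniqueness of identity proofs on objects is what recovers equality of the
    morphisms. *)
Lemma Arrow_inj (X Y : C) (f g : hom X Y) : f ≡ g -> f = g.
Proof.
intros e; injection e as e; now apply inj_pair2, inj_pair2 in e.
Qed.

Definition cast_act (K : EM T) (X : C) (e : carrier K = X) : hom (T X) X :=
  eq_rect (carrier K) (fun X => hom (T X) X) (act K) X e.

Lemma cast_act_algebra (K : EM T) (X : C) (e : carrier K = X) :
  is_algebra (cast_act e).
Proof. destruct e; apply act_is_algebra. Qed.

Lemma cast_algebra_eq (K : EM T) (X : C) (e : carrier K = X)
    (H : is_algebra (cast_act e)) :
  K = Build_Algebra H.
Proof.
destruct e, K as [X μ Hμ]; cbn in *.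
now rewrite (proof_irrelevance _ H Hμ).
Qed.

Lemma cast_act_equivariant (K L : EM T) (f : @hom (EM T) K L) (X Y : C)
    (eK : carrier K = X) (eL : carrier L = Y) (g : hom X Y) :
  alg_fun f ≡ g -> g ∘ cast_act eK = cast_act eL ∘ fmap T g.
Proof.
destruct eK, eL; intros e; apply Arrow_inj in e; subst g; apply alg_fun_comm.
Qed.

Section StrictTransport.

Variables (ST : SkewClosed (EM T)) (F : StrictlyClosed ST SC (forget T)).

Definition strict_act (M N : EM T) :
    hom (T ⟦carrier M, carrier N⟧) ⟦carrier M, carrier N⟧ :=
  @cast_act (bobj (@ihom _ ST) M N) ⟦carrier M, carrier N⟧ (strict_hom F M N).

Lemma strict_act_lifted : lifted_action strict_act.
Proof.
split.
- intros M N; apply cast_act_algebra.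
- intros M M' N N' f g.
  apply (cast_act_equivariant (f := bmap (@ihom _ ST) f g)).
  exact (strict_hom_natural F f g).
Qed.

(** The inner homs of the given structure on [EM T], and its unit, are equal but
    not identical to the algebras built on the corresponding objects of [C].
    Equivariance of [i] and [Γ] is known at the former and needed at the latter;
    the two outer actions agree after transport. *)
Lemma strict_act_cast (M N M' N' : EM T) (eM : M = M') (eN : N = N')
    (e : carrier (bobj (@ihom _ ST) M N) = ⟦carrier M', carrier N'⟧) :
  cast_act e = strict_act M' N'.
Proof.
destruct eM, eN; unfold strict_act.
now rewrite (proof_irrelevance _ e (strict_hom F M N)).
Qed.

Lemma lifted_structure_of_strictly_closed : has_lifted_structure.
Proof.
pose (e1 := strict_one F : carrier (@one _ ST) = one).
pose (H1 := cast_act_algebra e1).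
exists (cast_act e1), H1, strict_act, strict_act_lifted.
pose proof (cast_algebra_eq H1) as E1.
assert (EH : forall M N : EM T,
  bobj (@ihom _ ST) M N = hom_algebra strict_act_lifted M N).
{ intros M N; apply cast_algebra_eq. }
split.
- intros M.
  assert (e : carrier (bobj (@ihom _ ST) one M) = ⟦one, carrier M⟧).
  { rewrite EH; cbn; now rewrite e1. }
  rewrite <- (strict_act_cast E1 eq_refl e).
  exact (cast_act_equivariant e eq_refl (strict_i F M)).
- intros M. exact (cast_act_equivariant e1 (strict_hom F M M) (strict_j F M)).
- intros P M N.
  assert (e : carrier (bobj (@ihom _ ST) (bobj (@ihom _ ST) P M)
                         (bobj (@ihom _ ST) P N))
    = ⟦⟦carrier P, carrier M⟧, ⟦carrier P, carrier N⟧⟧).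
  { now rewrite !EH. }
  rewrite <- (strict_act_cast (EH P M) (EH P N) e).
  exact (cast_act_equivariant (strict_hom F M N) e (strict_Γ F P M N)).
Qed.

End StrictTransport.

End Lifts.

Theorem theorem3p4 (C : Category) (SC : SkewClosed C) (T : Monad C) :
  (exists ST : SkewClosed (EM T), StrictlyClosed ST SC (forget T))
  <->
  (exists (μ1 : hom (T one) one)
          (s : forall X Y : C, hom (T ⟦T X, Y⟧) ⟦X, T Y⟧),
     is_algebra μ1 /\
     lifts_hom T s /\
     (forall X : C,
        fmap T (i X) = i (T X) ∘ s one X ∘ fmap T ⟪μ1, idm X⟫) /\
     (forall M : EM T,
        j (carrier M) ∘ μ1
        = ⟪idm (carrier M), act M ∘ m T (carrier M)⟫
            ∘ s (carrier M) (T (carrier M)) ∘ fmap T (j (T (carrier M)))) /\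
     (forall (X Y : C) (P : EM T),
        Γ (carrier P) X (T Y) ∘ s X Y
        = ⟪⟪act P, idm X⟫, s (carrier P) Y⟫
            ∘ s ⟦T (carrier P), X⟧ ⟦T (carrier P), Y⟧
            ∘ fmap T ⟪s (carrier P) X, ⟪act P, idm Y⟫⟫
            ∘ fmap T (Γ (carrier P) (T X) Y))).
Proof.
split.
- intros [ST F].
  destruct (lifted_structure_of_strictly_closed F) as (μ1 & H1 & a & L & [Ki Kj KΓ]).
  pose proof (lift_of_lifts L) as Hs.
  pose proof (fun M N => eq_sym (action_of_lift_of L M N)) as Ea.
  exists μ1, (lift_of a).
  split; [exact H1 | split; [exact Hs | split; [|split]]].
  + now apply (i_coherence Hs Ea H1).
  + now apply (j_coherence Hs Ea).
  + now apply (Γ_coherence Hs L Ea).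
- intros (μ1 & s & H1 & Hs & Ki & Kj & KΓ).
  pose (L := action_of_lifted Hs).
  assert (K : coherent_action H1 L).
  { split.
    - now apply (i_coherence Hs (fun M N => eq_refl)).
    - now apply (j_coherence Hs (fun M N => eq_refl)).
    - now apply (Γ_coherence Hs L (fun M N => eq_refl)). }
  exact (ex_intro _ (EM_skew_closed K) (EM_strictly_closed K)).
Qed.
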